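(* For any LB-space $(E,\tau)$ the following are equivalent: (i) $(E,\tau)$ is a regular LB-space. (ii) $(E,\tau)^{\mathrm b}\in\mathbf{bLB}$. (iii) $(E,\tau)^{\mathrm b}\in\mathbf{LBb}$. (iv) $(E,\tau)^{\mathrm b}\in\mathbf{CBorn}$.
   Context: Let $k\in\{\mathbb{R},\mathbb{C}\}$. A bornological $k$-vector space of convex type (bvs) is a $k$-vector space $E$ with a family $\mathcal{B}$ of subsets (''bounded sets'') that covers $E$ and is closed under subsets, finite unions, sums, scalar multiples and absolutely convex hulls; morphisms are the linear maps sending bounded sets to bounded sets. $\mathbf{Born}$ is the category of bvs. $\mathbf{Tc}$ is the category of (possibly non-Hausdorff) locally convex topological $k$-vector spaces (lcs) and continuous linear maps. The functor $(\cdot)^{\mathrm b}\colon\mathbf{Tc}\to\mathbf{Born}$ equips $(E,\tau)$ with all its $\tau$-bounded sets. (Semi-)normed spaces are regarded as lcs. $\mathbf{CBorn}\subseteq\mathbf{Born}$ is the full subcategory of separated complete bvs: those in which every bounded set is contained in a bounded Banach disk, i.e. in an absolutely convex $B\in\mathcal{B}$ such that $E_B=\operatorname{span}B$ with the Minkowski functional $\|e\|_B=\inf\{\lambda>0:e\in\lambda B\}$ is a Banach space. An LB-space is an lcs $(E,\tau)\cong\operatorname{colim}_{n\in\mathbb{N}}(E_n,\|\cdot\|_n)$ (colimit in $\mathbf{Tc}$) for some sequence of Banach spaces $(E_1,\|\cdot\|_1)\to(E_2,\|\cdot\|_2)\to\cdots$ with injective continuous linear linking maps (a defining sequence); it need not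 be Hausdorff. An LB-space is regular if $(E,\tau)^{\mathrm b}\cong\operatorname{colim}_n(E_n,\|\cdot\|_n)^{\mathrm b}$ in $\mathbf{Born}$ for some (equivalently, every) defining sequence; that is, every bounded subset of $(E,\tau)$ is contained and bounded in some $(E_n,\|\cdot\|_n)$. $\mathbf{bLB}$ is the full subcategory of $\mathbf{Born}$ of all bvs isomorphic to $(F,\sigma)^{\mathrm b}$ for some regular LB-space $(F,\sigma)$. $\mathbf{LBb}$ is the full subcategory of $\mathbf{Born}$ of all bvs isomorphic to $\operatorname{colim}_{n\in\mathbb{N}}(E_n,\|\cdot\|_n)^{\mathrm b}$ (colimit in $\mathbf{Born}$) for a sequence of Banach spaces with injective continuous linear linking maps; in such a colimit the underlying space is the union of the $E_n$ and a set is bounded iff it is contained and bounded in some $E_n$. *)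

(* Defs.v *)
From HB Require Import structures.
From mathcomp Require Import all_boot all_order all_algebra.
From mathcomp Require Import all_classical all_reals all_analysis.
From mathcomp.real_closed Require Import complex.

Set Implicit Arguments.
Unset Strict Implicit.
Unset Printing Implicit Defensive.

Import Order.TTheory GRing.Theory Num.Theory.
Import numFieldNormedType.Exports.

Local Open Scope classical_set_scope.
Local Open Scope ring_scope.

Inductive scalar_kind := RealScalars | ComplexScalars.

Definition base_field (R : realType) (k : scalar_kind) : numFieldType :=
  match k with
  | RealScalars => R
  | ComplexScalars => R[i]
  end.

Definition real_scalar (R : realType) (k : scalar_kind) : R -> base_field R k :=
  match k with
  | RealScalars => fun x => x
  | ComplexScalars => fun x => x%:C%C
  end.

Section Disks.
Context (K : numFieldType) (E : lmodType K).
Implicit Types A B : set E.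

Definition absolutely_convex A :=
  forall (a b : K) (x y : E),
    `|a| + `|b| <= 1 -> A x -> A y -> A (a *: x + b *: y).

Definition is_subspace A :=
  A 0 /\ forall (a : K) (x y : E), A x -> A y -> A (a *: x + y).

Definition abs_convex_hull A : set E := smallest absolutely_convex A.

Definition lspan A : set E := smallest is_subspace A.

Definition set_scale (a : K) A : set E := [set a *: x | x in A].

Definition set_add A B : set E := [set x + y | x in A & y in B].

End Disks.

Record bvs (K : numFieldType) := Bvs {
  bvs_space :> lmodType K;
  bounded : set_system bvs_space;
  bounded_cover : \bigcup_(A in bounded) A = setT;
  bounded_subset : forall A B, A `<=` B -> bounded B -> bounded A;
  bounded_setU : forall A B, bounded A -> bounded B -> bounded (A `|` B);
  bounded_add : forall A B, bounded A -> bounded B -> bounded (set_add A B);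
  bounded_scale : forall (a : K) A, bounded A -> bounded (set_scale a A);
  bounded_hull : forall A, bounded A -> bounded (abs_convex_hull A)
}.

Definition bornological (K : numFieldType) (X Y : bvs K) (f : X -> Y) :=
  forall A, bounded A -> bounded (f @` A).

Definition born_iso (K : numFieldType) (X Y : bvs K) :=
  exists (f : {linear X -> Y}) (g : {linear Y -> X}),
    [/\ bornological f, bornological g, cancel f g & cancel g f].

Section VonNeumann.
Context (K : numFieldType) (E : tvsType K).
Implicit Types A B U V : set E.

Definition vn_bounded A :=
  forall U, nbhs (0 : E) U ->
    exists2 r : K, 0 < r & forall l : K, r <= `|l| -> A `<=` set_scale l U.

Lemma abs_convex_nbhs U : nbhs (0 : E) U ->
  exists V, [/\ nbhs (0 : E) V, absolutely_convex V & V `<=` U].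
Proof.
move=> U0; have [Bs Bconv [Bopen Bbasis]] := @locally_convex K E.
have [C [BC C0] CU] := Bbasis 0 U U0.
have cC : convex_set C by apply: Bconv; rewrite inE.
have nC : nbhs (0 : E) C by apply: open_nbhs_nbhs; split => //; exact: Bopen.
have := @scale_continuous K E (0, 0) C; rewrite /= scale0r => /(_ nC).
move=> [[D W] /= [nD nW] DW].
have [e /= e0 eD] : exists2 e : K, 0 < e & forall l : K, `|l| < e -> D l.
  have [e e0 He] := proj1 (@nbhs_ballP K K^o 0 D) nD.
  by exists e => // l le; apply: He; rewrite /ball /= sub0r normrN.
pose V : set E := [set x | forall l : K, `|l| <= 1 -> C (l *: x)].
exists V; split; last 1 first.
- by move=> x /(_ 1); rewrite normr1 scale1r lexx => /(_ isT) /CU.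
- have e20 : e / 2 != 0 by rewrite mulf_neq0 ?invr_eq0 ?pnatr_eq0 // gt_eqF.
  apply: filterS (nbhs0Z e20 nW) => _ [w Ww <-] l l1.
  rewrite scalerA; apply: (DW (l * (e / 2), w)); split => //=; apply: eD.
  rewrite normrM (gtr0_norm (divr_gt0 e0 (ltr0Sn _ 1))).
  apply: le_lt_trans (_ : e / 2 < e).
    by rewrite ler_piMl// ltW// divr_gt0.
  by rewrite ltr_pdivrMr// ltr_pMr// ltr1n.
- move=> a b x y ab Vx Vy l l1.
  have [s0|s0] := eqVneq (`|a| + `|b|) 0.
    have /andP[/eqP a0 /eqP b0] : (a == 0) && (b == 0).
      by rewrite -(normr_eq0 a) -(normr_eq0 b) -paddr_eq0 ?normr_ge0// s0.
    by rewrite a0 b0 !scale0r addr0 scaler0.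
  set s := `|a| + `|b| in ab s0.
  have sge : 0 <= s by rewrite addr_ge0.
  pose t := `|a| / s.
  have t0 : 0 <= t by rewrite divr_ge0.
  have t1 : t <= 1.
    by rewrite ler_pdivrMr ?mul1r ?lerDl ?lt_def ?s0 ?sge.
  have tE : 1 - t = `|b| / s.
    by rewrite /t -[1](divff s0) -mulrBl /s addrC addKr.
  have sub1 (c : K) : `|l * (s * (c / `|c|))| <= 1.
    rewrite normrM mulr_ile1 ?normr_ge0// normrM normf_div normr_id (ger0_norm sge).
    have [->|c0] := eqVneq c 0; first by rewrite normr0 mul0r mulr0.
    by rewrite divff ?mulr1// normr_eq0.
  have sN (c : K) : `|c| / s * (s * (c / `|c|)) = c.
    have [->|c0] := eqVneq c 0; first by rewrite normr0 !mul0r.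
    by rewrite mulrA divfK// mulrC divfK// normr_eq0.
  have -> : l *: (a *: x + b *: y) =
      t *: ((l * (s * (a / `|a|))) *: x) +
      (1 - t) *: ((l * (s * (b / `|b|))) *: y).
    rewrite tE /t !scalerA scalerDr !scalerA.
    by rewrite [_ / s * (l * _)]mulrCA sN [_ / s * (l * _)]mulrCA sN.
  apply/set_mem.
  exact: (cC _ _ (Itv01 t0 t1) (mem_set (Vx _ (sub1 a)))
    (mem_set (Vy _ (sub1 b)))).
Qed.

Lemma vn_bounded_cover : \bigcup_(A in vn_bounded) A = setT.
Proof.
rewrite -subTset => x _; exists [set x] => // U U0.
have := @scale_continuous K E (0, x) U; rewrite /= scale0r => /(_ U0).
move=> [[D W] /= [nD nW] DW].
have [e e0 He] := proj1 (@nbhs_ballP K K^o 0 D) nD.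
exists (e^-1 + 1) => [|l le _ ->]; first by rewrite addr_gt0// invr_gt0.
have l0 : 0 < `|l| by apply: lt_le_trans le; rewrite addr_gt0// invr_gt0.
have ln0 : l != 0 by rewrite -normr_gt0.
exists (l^-1 *: x); last by rewrite scalerA divff// scale1r.
apply: (DW (l^-1, x)); split => /=; last exact: nbhs_singleton.
apply: He; rewrite /ball /= sub0r normrN normfV invf_plt ?posrE//.
by apply: lt_le_trans le; rewrite ltrDl.
Qed.

Lemma vn_bounded_subset A B : A `<=` B -> vn_bounded B -> vn_bounded A.
Proof.
move=> AB bB U /bB[r r0 rB]; exists r => // l /rB.
exact: subset_trans.
Qed.

Lemma vn_bounded_setU A B : vn_bounded A -> vn_bounded B -> vn_bounded (A `|` B).
Proof.
move=> bA bB U U0; have [r r0 rA] := bA U U0; have [s s0 sB] := bB U U0.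
exists (r + s) => [|l le]; first exact: addr_gt0.
rewrite subUset; split; [apply: rA|apply: sB]; apply: le_trans le.
  by rewrite lerDl ltW.
by rewrite lerDr ltW.
Qed.

Lemma vn_bounded_add A B :
  vn_bounded A -> vn_bounded B -> vn_bounded (set_add A B).
Proof.
move=> bA bB U U0.
have := @add_continuous E (0, 0) U; rewrite /= addr0 => /(_ U0).
move=> [[V W] /= [nV nW] VW].
have [r r0 rA] := bA V nV; have [s s0 sB] := bB W nW.
exists (r + s) => [|l le]; first exact: addr_gt0.
move=> _ [x Ax [y By <-]].
have [|v Vv <-] := rA l _ x Ax; first by apply: le_trans le; rewrite lerDl ltW.
have [|w Ww <-] := sB l _ y By; first by apply: le_trans le; rewrite lerDr ltW.
by exists (v + w); [exact: (VW (v, w))|rewrite scalerDr].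
Qed.

Lemma vn_bounded_scale (a : K) A : vn_bounded A -> vn_bounded (set_scale a A).
Proof.
move=> bA U U0; have [r r0 rA] := bA U U0.
have [->|a0] := eqVneq a 0.
  exists 1 => // l _ _ [x _ <-]; exists 0; first exact: nbhs_singleton.
  by rewrite scale0r scaler0.
exists (`|a| * r) => [|l le _ [x Ax <-]]; first by rewrite mulr_gt0 ?normr_gt0.
have [|u Uu <-] := rA (l / a) _ x Ax.
  by rewrite normf_div ler_pdivlMr ?normr_gt0// mulrC.
by exists u => //; rewrite scalerA [a * _]mulrC divfK.
Qed.

Lemma vn_bounded_hull A : vn_bounded A -> vn_bounded (abs_convex_hull A).
Proof.
move=> bA U /abs_convex_nbhs[V [nV cV VU]].
have [r r0 rA] := bA V nV; exists r => // l /rA AV.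
suff : abs_convex_hull A `<=` set_scale l V.
  by move=> /subset_trans; apply; exact: image_subset.
apply: smallest_sub => // a b _ _ ab [x Vx <-] [y Vy <-].
exists (a *: x + b *: y); first exact: cV.
by rewrite scalerDr !scalerA ![l * _]mulrC.
Qed.

Definition born_of : bvs K :=
  Bvs vn_bounded_cover vn_bounded_subset vn_bounded_setU vn_bounded_add
    vn_bounded_scale vn_bounded_hull.

End VonNeumann.

Record banach_seq (K : numFieldType) := BanachSeq {
  banach_step :> nat -> completeNormedModType K;
  banach_link : forall n, {linear banach_step n -> banach_step n.+1};
  banach_link_continuous : forall n, continuous (banach_link n);
  banach_link_inj : forall n, injective (banach_link n)
}.

Section Colimits.
Context (K : numFieldType) (E : banach_seq K).

Definition tc_cocone (F : tvsType K) (j : forall n, {linear E n -> F}) :=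
  (forall n, continuous (j n)) /\
  (forall n x, j n.+1 (banach_link E n x) = j n x).

Definition tc_colimit (F : tvsType K) (j : forall n, {linear E n -> F}) :=
  tc_cocone j /\
  forall (G : tvsType K) (g : forall n, {linear E n -> G}), tc_cocone g ->
    exists h : {linear F -> G},
      [/\ continuous h,
          forall n x, h (j n x) = g n x &
          forall h' : {linear F -> G}, continuous h' ->
            (forall n x, h' (j n x) = g n x) -> h' =1 h].

Definition born_cocone (X : bvs K)
    (j : forall n, {linear born_of (E n) -> X}) :=
  (forall n, bornological (j n)) /\
  (forall n x, j n.+1 (banach_link E n x) = j n x).

Definition born_colimit (X : bvs K)
    (j : forall n, {linear born_of (E n) -> X}) :=
  born_cocone j /\
  forall (Y : bvs K) (g : forall n, {linear born_of (E n) -> Y}),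
    born_cocone g ->
    exists h : {linear X -> Y},
      [/\ bornological h,
          forall n x, h (j n x) = g n x &
          forall h' : {linear X -> Y}, bornological h' ->
            (forall n x, h' (j n x) = g n x) -> h' =1 h].

End Colimits.

Definition LB_space (K : numFieldType) (E : tvsType K) :=
  exists (S : banach_seq K) (j : forall n, {linear S n -> E}), tc_colimit j.

(* The isomorphism E^b = colim (S n)^b required of a regular space is the
   canonical one: the same cocone j is a colimit in both categories. *)
Definition regular_LB_space (K : numFieldType) (E : tvsType K) :=
  exists (S : banach_seq K) (j : forall n, {linear S n -> E}),
    tc_colimit j /\ born_colimit (X := born_of E) j.

Definition in_bLB (K : numFieldType) (X : bvs K) :=
  exists2 F : tvsType K, regular_LB_space F & born_iso X (born_of F).

Definition in_LBb (K : numFieldType) (X : bvs K) :=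
  exists (S : banach_seq K) (j : forall n, {linear born_of (S n) -> X}),
    born_colimit j.

Section CompleteBornologies.
Context (R : realType) (k : scalar_kind) (X : bvs (base_field R k)).

Definition minkowski (B : set X) (x : X) : R :=
  inf [set l : R | 0 < l /\ set_scale (real_scalar k l) B x].

(* (span B, minkowski B) is a Banach space: it is the isometric linear image of
   a library Banach space V, whose norm takes its values in the scalar field. *)
Definition banach_disk (B : set X) :=
  absolutely_convex B /\
  exists (V : completeNormedModType (base_field R k)) (f : {linear V -> X}),
    [/\ injective f, range f = lspan B &
        forall v, `|v| = real_scalar k (minkowski B (f v))].

Definition in_CBorn :=
  forall A : set X, bounded A ->
    exists B : set X, [/\ A `<=` B, bounded B & banach_disk B].

End CompleteBornologies.

(* Main.v *)
Require Import Defs.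
From HB Require Import structures.
From mathcomp Require Import all_boot all_order all_algebra.
From mathcomp Require Import all_classical all_reals all_analysis.
From mathcomp.real_closed Require Import complex.

Set Implicit Arguments.
Unset Strict Implicit.
Unset Printing Implicit Defensive.

Import Order.TTheory GRing.Theory Num.Theory.
Import numFieldNormedType.Exports.

Local Open Scope classical_set_scope.
Local Open Scope ring_scope.

(** A regular space is its own witness for (ii), and an
isomorphism of bornological spaces carries a colimit cocone to a colimit
cocone, so (ii) gives (iii).  For (iii) -> (iv), let [j n : S n -> X] be a
colimit cocone in the category of bornological spaces.  Every bounded set of
[X] lies in the image of some ball of some [S n] ([born_colimit_bounded]), and
since [j n] is injective, the image of a ball of [S n] is a Banach disk whose
normed space is a rescaled copy of [S n] ([unit_ball_banach_disk]).

The implication (iv) -> (i) is Grothendieck's factorization theorem.  When every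
bounded set of [E] sits in a bounded Banach disk, [E] is Hausdorff: the closure
of 0 is a bounded subspace, and a Banach disk containing a line would have a
nonzero vector of norm 0 ([CBorn_separated]).  Given a bounded Banach disk [B],
the inclusion [f] of its Banach space [V] into [E] is continuous, and [E] is
the union of the images of the steps [S n].  By Baire's theorem some set of
those [v] such that [f v] is in the image of a given ball of [S n] is dense in a
ball of [V]; the successive approximation argument of the open mapping theorem,
which may be run in [S n] because limits in [E] are unique, then puts [B]
inside the image of a ball of [S n] ([banach_factorization]).  So the bounded
sets of [E] are exactly those that come from the steps, and the same cocone is
a colimit of bornological spaces.

Both directions need to know that a colimit cocone, topological or
bornological, is injective and jointly surjective.  Every linear map into a
space with the indiscrete topology is continuous, and into a space whose
subsets are all bounded it is bounded, so either kind of colimit is a colimit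
of bare vector spaces ([tc_colimit_direct_limit], [born_colimit_direct_limit]).
The universal property in vector spaces, applied to retractions and projectors,
which exist by Zorn's lemma, gives both facts without constructing any direct
limit. *)

(** * Projectors, retractions and direct limits of vector spaces *)

Section LinearAlgebra.
Context (K : fieldType).
Implicit Types (V W X Y : lmodType K).

Lemma linear_bundle V W (f : V -> W) :
  linear f -> exists g : {linear V -> W}, g =1 f.
Proof.
move=> fL; pose m := GRing.isLinear.Build K V W *:%R f fL.
by exists (HB.pack_for {linear V -> W} f m).
Qed.

(** Zorn's lemma provides a maximal subset [M] that is closed under linear
combinations and meets [U] only in 0; it is a complement of [U], and the map
sought is the projector onto [U] along [M]. *)
Lemma subspace_projector X (U : set X) :
  U 0 -> (forall (a : K) x y, U x -> U y -> U (a *: x + y)) ->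
  exists P : {linear X -> X}, (forall x, U (P x)) /\ (forall x, U x -> P x = x).
Proof.
move=> U0 Ulin.
(* Membership of 0 is not required of [M]: the union of the empty chain is
   empty. *)
pose D (M : set X) := (forall (a : K) x y, M x -> M y -> M (a *: x + y)) /\
  forall x, M x -> U x -> x = 0.
have [M [[Wlin WU] Wmax]] : exists M, D M /\ forall B, M `<` B -> ~ D B.
  apply: Zorn_bigcup => F FD Ftot; split=> [a x y [A FA Ax] [B FB By]|x [A FA Ax]].
    have [AB|BA] := Ftot A B FA FB.
      by exists B => //; apply: (proj1 (FD _ FB)) => //; exact: AB.
    by exists A => //; apply: (proj1 (FD _ FA)) => //; exact: BA.
  exact: (proj2 (FD _ FA)).
have W0 : M 0.
  have [[x Wx]|/set0P/negP/negPn/eqP W0] := pselect (M !=set0).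
    by rewrite -(addNr x) -scaleN1r; exact: Wlin.
  exfalso; apply: (Wmax [set 0]); last first.
    by split=> [a x y -> ->|x -> //]; rewrite scaler0 addr0.
  by split; [rewrite W0|move=> /(_ 0 erefl); rewrite W0].
have dec x : exists u, U u /\ M (x - u).
  apply: contrapT => nx.
  apply: (Wmax [set y | exists a w, M w /\ y = a *: x + w]); last first.
    split=> [a _ _ [b [w [Ww ->]]] [c [z [Wz ->]]]|_ [a [w [Ww ->]] Uaw]].
      exists (a * b + c), (a *: w + z); split; first exact: Wlin.
      by rewrite scalerDl scalerDr scalerA addrACA.
    have [a0|a0] := eqVneq a 0.
      by move: Uaw; rewrite a0 scale0r add0r; exact: WU.
    exfalso; apply: nx; exists (a^-1 *: (a *: x + w)); split.
      by rewrite -[_ *: _]addr0; exact: Ulin.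
    rewrite scalerDr scalerA mulVf// scale1r opprD addrA subrr add0r -scaleNr.
    by rewrite -[_ *: _]addr0; exact: Wlin.
  split=> [w Ww|sub]; first by exists 0, w; rewrite scale0r add0r.
  apply: nx; exists 0; split; rewrite ?subr0//.
  by apply: sub; exists 1, 0; rewrite scale1r addr0.
have [p pP] := choice dec.
(* The decomposition of [x] along [U] and [M] is unique. *)
have uniq x u : U u -> M (x - u) -> u = p x.
  move=> Uu Wu; have [Up Wp] := pP x; apply/eqP; rewrite -subr_eq0; apply/eqP.
  apply: WU; last by rewrite addrC -scaleN1r; exact: Ulin.
  have := Wlin (-1) _ _ Wu Wp.
  by rewrite scaleN1r opprB addrA subrK.
have [P PE] : exists P : {linear X -> X}, P =1 p.
  apply: linear_bundle => a x y; apply/esym/uniq.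
    by apply: Ulin; [have [] := pP x|have [] := pP y].
  rewrite opprD addrACA -scalerBr.
  by apply: Wlin; [have [] := pP x|have [] := pP y].
exists P; split=> x; rewrite PE; first by have [] := pP x.
by move=> Ux; apply/esym/uniq => //; rewrite subrr.
Qed.

Lemma injective_retraction V W (i : {linear V -> W}) :
  injective i -> exists r : {linear W -> V}, cancel i r.
Proof.
move=> iI.
have [||P [Pr Pid]] := @subspace_projector W (range i).
- by exists 0 => //; rewrite linear0.
- by move=> a _ _ [x _ <-] [y _ <-]; exists (a *: x + y) => //; rewrite linearP.
have /choice[s sP] : forall w, exists v, i v = P w.
  by move=> w; have [v _ <-] := Pr w; exists v.
have [r rE] : exists r : {linear W -> V}, r =1 s.
  by apply: linear_bundle => a x y; apply: iI; rewrite !(linearP, sP).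
by exists r => x; rewrite rE; apply: iI; rewrite sP; apply: Pid; exists x.
Qed.

End LinearAlgebra.

Section DirectLimit.
Context (K : fieldType).
Implicit Types (S : nat -> lmodType K) (X Y : lmodType K).

Definition linear_cocone S (link : forall n, {linear S n -> S n.+1}) Y
    (g : forall n, {linear S n -> Y}) :=
  forall n x, g n.+1 (link n x) = g n x.

(** The universal property of the colimit in the category of vector spaces, with
the uniqueness part stated for arbitrary pairs of maps. *)
Definition direct_limit S (link : forall n, {linear S n -> S n.+1}) X
    (j : forall n, {linear S n -> X}) :=
  [/\ linear_cocone link j,
      forall Y (g : forall n, {linear S n -> Y}), linear_cocone link g ->
        exists h : {linear X -> Y}, forall n x, h (j n x) = g n x &
      forall Y (h h' : {linear X -> Y}),
        (forall n x, h (j n x) = h' (j n x)) -> h =1 h'].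

(** Beyond [n] the cocone extends by composing with retractions of the links.
Induction on [n], shifting the sequence by one, avoids any transport between
the types [S m]. *)
Lemma cocone_extension S (link : forall n, {linear S n -> S n.+1}) Y n
    (phi : {linear S n -> Y}) :
  (forall n, injective (link n)) ->
  exists2 g, linear_cocone link g & g n =1 phi.
Proof.
elim: n S link phi => [|n IHn] S link phi linkI.
  have [r rK] : exists r : forall n, {linear S n.+1 -> S n},
      forall n, cancel (link n) (r n).
    pose rP n := cid (injective_retraction (linkI n)).
    by exists (fun n => projT1 (rP n)) => n; exact: projT2 (rP n).
  pose g := nat_rect (fun n => {linear S n -> Y}) phi
    (fun n gn => gn \o r n : {linear _ -> _}).
  by exists g => // n x /=; rewrite rK.
have [g gc gn] :=
  IHn (fun n => S n.+1) (fun n => link n.+1) phi (fun n => linkI n.+1).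
exists (fun m => match m return {linear S m -> Y} with
  | 0 => g 0 \o link 0 : {linear _ -> _} | m.+1 => g m end) => // -[|m] x //=.
Qed.

Context S (link : forall n, {linear S n -> S n.+1}) X
  (j : forall n, {linear S n -> X}).
Hypothesis j_lim : direct_limit link j.

(** Some cocone starts with the identity of [S n], and it factors through
[j n]. *)
Lemma direct_limit_inj n : (forall n, injective (link n)) -> injective (j n).
Proof.
move=> linkI x y jxy; have [_ jE _] := j_lim.
have [g /jE[h hj] gn] := cocone_extension (idfun : {linear S n -> S n}) linkI.
by have := hj n x; rewrite jxy hj !gn.
Qed.

Lemma direct_limit_range n m : (n <= m)%N -> range (j n) `<=` range (j m).
Proof.
have [jc _ _] := j_lim; elim: m => [|m IHm].
  by rewrite leqn0 => /eqP ->.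
rewrite leq_eqVlt ltnS => /predU1P[-> //|/IHm nm].
by apply: (subset_trans nm) => _ [x _ <-]; exists (link m x).
Qed.

(** A projector onto the union of the ranges agrees with the identity on each
range, hence everywhere. *)
Lemma direct_limit_cover : \bigcup_n range (j n) = setT.
Proof.
have [jc _ jU] := j_lim; set U := \bigcup_n _.
have [||P [PU Pid]] := @subspace_projector _ X U.
- by exists 0%N => //; exists 0 => //; rewrite linear0.
- move=> a x y [n _ jx] [m _ jy].
  have [x' _ <-] := direct_limit_range (leq_maxl n m) jx.
  have [y' _ <-] := direct_limit_range (leq_maxr n m) jy.
  exists (maxn n m) => //; exists (a *: x' + y') => //; exact: linearP.
rewrite -subTset => x _.
rewrite -[x]/((idfun : {linear X -> X}) x) -(jU _ P); first exact: PU.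
by move=> n y; rewrite Pid//; exists n => //; exists y.
Qed.

End DirectLimit.

(** * Colimits of topological and bornological spaces are direct limits *)

Section Coarse.
Context (K : numFieldType).

(** An alias, so that the topology does not attach to [X] itself. *)
Definition indiscrete (X : Type) : Type := X.

HB.instance Definition _ (X : lmodType K) := GRing.Lmodule.on (indiscrete X).

Section IndiscreteTopology.
Context (X : lmodType K).

Let indiscrete_cover : \bigcup_(i in [set: unit]) [set: indiscrete X] = setT.
Proof. by rewrite -subTset => x _; exists tt. Qed.

Let indiscrete_join (i j : unit) (x : indiscrete X) :
  [set: unit] i -> [set: unit] j -> [set: indiscrete X] x ->
  [set: indiscrete X] x -> exists k : unit,
    [/\ [set: unit] k, [set: indiscrete X] x &
        [set: indiscrete X] `<=` [set: indiscrete X] `&` [set: indiscrete X]].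
Proof. by exists tt; split. Qed.

HB.instance Definition _ := @isBaseTopological.Build (indiscrete X)
  unit setT (fun _ => setT) indiscrete_cover indiscrete_join.

Lemma indiscrete_nbhs (x : indiscrete X) A : nbhs x A -> A = setT.
Proof.
rewrite nbhsE => [[B [[D _ <-] [i Di _]] BA]]; rewrite -subTset.
by apply: subset_trans BA => y _; exists i.
Qed.

Lemma indiscrete_continuous (T : topologicalType) (f : T -> indiscrete X) :
  continuous f.
Proof. by move=> x A /indiscrete_nbhs ->; exact: filterT. Qed.

Let indiscrete_convex :
  exists2 B : set_system (indiscrete X),
    (forall b, b \in B -> convex_set b) & basis B.
Proof.
exists [set setT]; first by move=> b /set_mem -> x y l _ _; exact/mem_set.
split; first by move=> _ ->; exact: openT.
by move=> x A /indiscrete_nbhs ->; exists setT.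
Qed.

HB.instance Definition _ := PreTopologicalNmodule_isTopologicalNmodule.Build
  (indiscrete X) (@indiscrete_continuous _ _).
HB.instance Definition _ := TopologicalNmodule_isTopologicalLmodule.Build
  K (indiscrete X) (@indiscrete_continuous _ _).
(* The next instance supplies the uniform structure. *)
HB.instance Definition _ := PreTopologicalLmod_isTvs.Build K (indiscrete X)
  (@indiscrete_continuous _ _) (@indiscrete_continuous _ _) indiscrete_convex.
HB.instance Definition _ := Uniform_isTvs.Build K (indiscrete X) indiscrete_convex.

End IndiscreteTopology.

Definition coarse (X : lmodType K) : bvs K.
Proof.
refine (@Bvs K X (fun=> True) _ _ _ _ _ _) => //.
by rewrite -subTset => x _; exists setT.
Defined.

(** Test the universal property against indiscrete spaces, where continuity is
no condition. *)
Lemma tc_colimit_direct_limit (S : banach_seq K) (F : tvsType K)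
    (j : forall n, {linear S n -> F}) :
  tc_colimit j -> direct_limit (S := fun n => S n) (@banach_link K S) j.
Proof.
move=> [[jC jc] jU]; split=> // Y.
  move=> g gc; have [|h [_ hj _]] := jU (indiscrete Y) g.
    by split=> // n; exact: indiscrete_continuous.
  by exists h.
move=> h h' hh'.
have [g gE] : exists g : forall n, {linear S n -> Y}, forall n x, g n x = h (j n x).
  by exists (fun n => h \o j n : {linear _ -> _}).
have [|l [_ _ lU]] := jU (indiscrete Y) g.
  by split=> [n|n x]; [exact: indiscrete_continuous|rewrite !gE jc].
move=> x; transitivity (l x); [|apply: esym]; apply: lU => //.
- exact: indiscrete_continuous.
- exact: indiscrete_continuous.
- by move=> n y; rewrite gE hh'.
Qed.

(** Test the universal property against coarse spaces, where boundedness is no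
condition. *)
Lemma born_colimit_direct_limit (S : banach_seq K) (X : bvs K)
    (j : forall n, {linear born_of (S n) -> X}) :
  born_colimit j -> direct_limit (S := fun n => S n) (@banach_link K S) j.
Proof.
move=> [[jC jc] jU]; split=> // Y.
  by move=> g gc; have [//|h [_ hj _]] := jU (coarse Y) g; exists h.
move=> h h' hh'.
have [g gE] : exists g : forall n, {linear S n -> Y}, forall n x, g n x = h (j n x).
  by exists (fun n => h \o j n : {linear _ -> _}).
have [|l [_ _ lU]] := jU (coarse Y) g; first by split=> // n x; rewrite !gE jc.
move=> x; transitivity (l x); [|apply: esym]; apply: lU => // n y.
  by rewrite gE.
by rewrite gE hh'.
Qed.

End Coarse.

(** * Bounded sets of a bornological colimit *)

Section BoundedSets.
Context (K : numFieldType).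

Definition cball (V : normedModType K) (r : K) : set V := [set x | `|x| <= r].

Lemma vn_bounded_cball (V : normedModType K) (r : K) : vn_bounded (@cball V r).
Proof.
move=> U /nbhs_ballP[e e0 eU]; exists ((`|r| + 1) / e).
  by rewrite divr_gt0// ltr_wpDl.
move=> l le x xr; have l0 : 0 < `|l|.
  by apply: lt_le_trans le; rewrite divr_gt0// ltr_wpDl.
have ln0 : l != 0 by rewrite -normr_gt0.
exists (l^-1 *: x); last by rewrite scalerA divff// scale1r.
apply: eU; rewrite -ball_normE /= sub0r normrN normrZ normfV mulrC ltr_pdivrMr//.
rewrite ler_pdivrMr// in le; rewrite mulrC; apply: lt_le_trans le.
apply: (@le_lt_trans _ _ `|r|); last by rewrite ltrDl.
by rewrite ger0_norm//; exact: le_trans xr.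
Qed.

Lemma vn_bounded_norm (V : normedModType K) (A : set V) :
  vn_bounded A -> exists2 r, 0 < r & A `<=` cball r.
Proof.
move=> /(_ _ (nbhsx_ballx 0 1 ltr01))[r r0 rA]; exists r => // x Ax.
have [|u] := rA r _ x Ax; first by rewrite gtr0_norm.
rewrite -ball_normE /= sub0r normrN => u1 <-.
by rewrite /cball/= normrZ gtr0_norm// ler_piMr ?ltW.
Qed.

Lemma linear_vn_bounded (E F : tvsType K) (f : {linear E -> F}) (A : set E) :
  continuous f -> vn_bounded A -> vn_bounded (f @` A).
Proof.
move=> fC bA U U0; have [|r r0 rA] := bA (f @^-1` U).
  by apply: fC; rewrite linear0.
exists r => // l /rA lA _ [x Ax <-]; have [u Uu <-] := lA x Ax.
by exists (f u) => //; rewrite linearZ.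
Qed.

Lemma image_cball_absolutely_convex (V : normedModType K) (X : lmodType K)
    (f : {linear V -> X}) r : absolutely_convex (f @` cball r).
Proof.
move=> a b _ _ ab [x xr <-] [y yr <-]; exists (a *: x + b *: y); last first.
  by rewrite linearD !linearZ.
have r0 : 0 <= r by apply: le_trans xr; exact: normr_ge0.
rewrite /cball /= (le_trans (ler_normD _ _))// !normrZ.
rewrite (le_trans (lerD (ler_wpM2l _ xr) (ler_wpM2l _ yr)))// -mulrDl.
by rewrite ler_piMl.
Qed.

End BoundedSets.

Section BornColimit.
Context (K : numFieldType) (S : banach_seq K) (X : lmodType K).
Variable j : forall n, {linear S n -> X}.

(** These sets will be the bounded sets of the colimit bornology on [X]. *)
Definition step_bounded (A : set X) :=
  exists n r, 0 < r /\ A `<=` j n @` cball r.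

Hypothesis j_cocone : linear_cocone (S := fun n => S n) (@banach_link K S) j.

Lemma step_bounded_widen n m r : (n <= m)%N -> 0 < r ->
  exists2 s, 0 < s & j n @` cball r `<=` j m @` cball s.
Proof.
move=> nm r0; elim: m nm => [|m IHm].
  by rewrite leqn0 => /eqP <-; exists r.
rewrite leq_eqVlt ltnS => /predU1P[<-|/IHm[s s0 rs]]; first by exists r.
have [t t0 st] := vn_bounded_norm (linear_vn_bounded
  (@banach_link_continuous K S m) (@vn_bounded_cball K (S m) s)).
exists t => //; apply: (subset_trans rs) => _ [x xs <-].
by exists (banach_link S m x); [apply: st; exists x|exact: j_cocone].
Qed.

Lemma step_bounded2 A B : step_bounded A -> step_bounded B ->
  exists n r, [/\ 0 < r, A `<=` j n @` cball r & B `<=` j n @` cball r].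
Proof.
move=> [n [r [r0 Ar]]] [m [s [s0 Bs]]].
have [r' r'0 rr'] := step_bounded_widen (leq_maxl n m) r0.
have [s' s'0 ss'] := step_bounded_widen (leq_maxr n m) s0.
have sub (t : K) : t <= r' + s' ->
    j (maxn n m) @` cball t `<=` j (maxn n m) @` cball (r' + s').
  by move=> tr; apply: image_subset => x xt; exact: le_trans xt tr.
exists (maxn n m), (r' + s'); split; first exact: addr_gt0.
- apply: (subset_trans Ar); apply: (subset_trans rr').
  by apply: sub; rewrite lerDl ltW.
- apply: (subset_trans Bs); apply: (subset_trans ss').
  by apply: sub; rewrite lerDr ltW.
Qed.

Hypothesis j_cover : \bigcup_n range (j n) = setT.

Lemma step_bounded_cover : \bigcup_(A in step_bounded) A = setT.
Proof.
rewrite -subTset => x _; have [n _ [y _ <-]] : (\bigcup_n range (j n)) x.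
  by rewrite j_cover.
exists [set j n y] => //; exists n, (`|y| + 1); split; first by rewrite ltr_wpDl.
by move=> _ ->; exists y => //; rewrite /cball/= lerDl.
Qed.

Lemma step_bounded_subset A B : A `<=` B -> step_bounded B -> step_bounded A.
Proof.
by move=> AB [n [r [r0 Br]]]; exists n, r; split=> //; exact: subset_trans Br.
Qed.

Lemma step_bounded_setU A B :
  step_bounded A -> step_bounded B -> step_bounded (A `|` B).
Proof.
move=> /step_bounded2/[apply] -[n [r [r0 Ar Br]]].
by exists n, r; split=> //; rewrite subUset.
Qed.

Lemma step_bounded_add A B :
  step_bounded A -> step_bounded B -> step_bounded (set_add A B).
Proof.
move=> /step_bounded2/[apply] -[n [r [r0 Ar Br]]].
exists n, (r + r); split; first exact: addr_gt0.
move=> _ [a /Ar[x xr <-] [b /Br[y yr <-] <-]].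
exists (x + y); last by rewrite linearD.
by rewrite /cball/= (le_trans (ler_normD _ _))// lerD.
Qed.

Lemma step_bounded_scale (a : K) A : step_bounded A -> step_bounded (set_scale a A).
Proof.
move=> [n [r [r0 Ar]]]; exists n, (`|a| * r + 1); split.
  by rewrite ltr_wpDl// mulr_ge0// ltW.
move=> _ [b /Ar[x xr <-] <-]; exists (a *: x); last by rewrite linearZ.
by rewrite /cball/= normrZ ler_wpDr// ler_wpM2l.
Qed.

Lemma step_bounded_hull A : step_bounded A -> step_bounded (abs_convex_hull A).
Proof.
move=> [n [r [r0 Ar]]]; exists n, r; split=> //; apply: smallest_sub => //.
exact: image_cball_absolutely_convex.
Qed.

Definition step_bvs : bvs K := Bvs step_bounded_cover step_bounded_subset
  step_bounded_setU step_bounded_add step_bounded_scale step_bounded_hull.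

End BornColimit.

(** The cocone is bounded into [X] with the bornology generated by the images of
balls.  The induced map from the colimit to this space is linear and fixes each
[j n x], so it is the identity; its boundedness is the claim. *)
Lemma born_colimit_bounded (K : numFieldType) (S : banach_seq K) (X : bvs K)
    (j : forall n, {linear born_of (S n) -> X}) (A : set X) :
  born_colimit j -> bounded A -> step_bounded (S := S) j A.
Proof.
move=> jB; have jL := born_colimit_direct_limit jB.
have jcov := direct_limit_cover jL; have [jc _ jU] := jL.
have [[jb _] jUB] := jB.
have [|h [hb hj _]] := jUB (step_bvs jc jcov) j.
  split=> // n B /vn_bounded_norm[r r0 Br]; exists n, r; split=> //.
  exact: image_subset.
have hid : h =1 (idfun : {linear X -> X}) by apply: jU.
move=> /hb /=; congr step_bounded; apply/seteqP; split=> x.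
  by move=> [y Ay <-]; rewrite hid.
by move=> Ax; exists x => //; rewrite hid.
Qed.

(** * Real scalars and Banach disks *)

Section RealScalar.
Context (R : realType) (k : scalar_kind).
Local Notation K := (base_field R k).
Local Notation real_scalar := (@real_scalar R k).

Lemma ler_real_scalar x y : (real_scalar x <= real_scalar y) = (x <= y).
Proof. by case: k => //=; rewrite lecR. Qed.

Lemma ltr_real_scalar x y : (real_scalar x < real_scalar y) = (x < y).
Proof. by case: k => //=; rewrite ltcR. Qed.

Lemma real_scalar0 : real_scalar 0 = 0.
Proof. by case: k. Qed.

Lemma real_scalar1 : real_scalar 1 = 1.
Proof. by case: k. Qed.

Lemma real_scalarX x n : real_scalar (x ^+ n) = real_scalar x ^+ n.
Proof. by case: k => //=; rewrite (rmorphXn (real_complex R)). Qed.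

Lemma real_scalar_half : real_scalar 2^-1 = 2^-1.
Proof. by case: k => //=; rewrite (fmorphV (real_complex R)) rmorph_nat. Qed.

Lemma real_scalar_ge0 (c : K) : 0 <= c -> exists2 x : R, 0 <= x & c = real_scalar x.
Proof.
case: k c => [c c0|[a b]].
  by exists c => //; exact: c0.
by rewrite lecE /= => /andP[/eqP b0 a0]; exists a; rewrite ?b0.
Qed.

(** The archimedean property, in the form that lets the completeness arguments
treat both scalar fields at once. *)
Lemma dyadic_lt (e : K) : 0 < e -> exists n, 2^-1 ^+ n < e.
Proof.
move=> e0; have [x x0 eE] := real_scalar_ge0 (ltW e0).
have {}x0 : 0 < x by rewrite -ltr_real_scalar real_scalar0 -eE.
exists (Num.truncn x^-1); rewrite eE -real_scalar_half -real_scalarX ltr_real_scalar.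
rewrite exprVn -[ltRHS]invrK ltf_pV2 ?posrE ?invr_gt0 ?exprn_gt0//.
apply: (lt_le_trans (truncnS_gt _)).
by rewrite -natrX ler_nat ltn_expl.
Qed.

End RealScalar.

Section BanachDisks.
Context (R : realType) (k : scalar_kind).
Local Notation K := (base_field R k).

(** For [l > 0], injectivity of [f] makes [f v] a point of [l B] exactly when
[`|v| <= l], so the Minkowski functional of [f v] is the norm of [v]. *)
Lemma unit_ball_banach_disk (V : completeNormedModType K) (X : bvs K)
    (f : {linear V -> X}) :
  injective f -> banach_disk (f @` cball 1).
Proof.
move=> fI; split; first exact: image_cball_absolutely_convex.
exists V, f; split=> // [|v].
  apply/seteqP; split.
    move=> _ [v _ <-] A [[A0 Alin] BA].
    have [->|v0] := eqVneq v 0; first by rewrite linear0.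
    have -> : f v = `|v| *: f (`|v|^-1 *: v) + 0.
      by rewrite -linearZ scalerA divff ?normr_eq0// scale1r addr0.
    apply: Alin => //; apply: BA; exists (`|v|^-1 *: v) => //.
    by rewrite /cball/= normrZ normfV normr_id mulVf// normr_eq0.
  apply: smallest_sub; last by move=> _ [v _ <-]; exists v.
  split; first by exists 0 => //; rewrite linear0.
  by move=> a _ _ [x _ <-] [y _ <-]; exists (a *: x + y) => //; rewrite linearP.
have [x x0 vE] := real_scalar_ge0 (normr_ge0 v); rewrite vE; congr real_scalar.
rewrite /Defs.minkowski; set L := (X in inf X).
have {L}-> : L = [set l | 0 < l /\ x <= l].
  apply/seteqP; split=> l [l0 H]; split=> //.
    case: H => _ [w w1 <-]; rewrite -linearZ => /fI vw.
    have L0 : 0 < real_scalar k l by rewrite -(real_scalar0 R k) ltr_real_scalar.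
    by rewrite -(ler_real_scalar k) -vE -vw normrZ gtr0_norm// ler_piMr// ltW.
  have L0 : 0 < real_scalar k l by rewrite -(real_scalar0 R k) ltr_real_scalar.
  exists (f ((real_scalar k l)^-1 *: v)); last first.
    by rewrite -linearZ scalerA divff ?gt_eqF// scale1r.
  exists ((real_scalar k l)^-1 *: v) => //.
  rewrite /cball/= normrZ normfV gtr0_norm// mulrC ler_pdivrMr// mul1r vE.
  by rewrite ler_real_scalar.
apply/eqP; rewrite eq_le; apply/andP; split.
  apply: lb_le_inf; first by exists (x + 1); split; rewrite ?ltr_wpDl// lerDl.
  by move=> l [].
apply/ler_addgt0Pl => e e0; apply: ge_inf; first by exists 0 => l [/ltW].
by split; rewrite ?ltr_pwDl// lerDr ltW.
Qed.

Section Minkowski.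
Context (X : bvs K) (B : set X) (V : completeNormedModType K) (f : {linear V -> X}).
Hypotheses (B_convex : absolutely_convex B) (f_range : range f = lspan B)
  (f_norm : forall v, `|v| = real_scalar k (Defs.minkowski B (f v))).

Lemma disk_sub_cball : B `<=` f @` cball 1.
Proof.
move=> b Bb; have : range f b by rewrite f_range => A [_]; exact.
move=> [v _ vb]; exists v => //; rewrite /cball/= f_norm vb -(real_scalar1 R k).
rewrite ler_real_scalar; apply: ge_inf; first by exists 0 => l [/ltW].
by split=> //; exists b => //; rewrite real_scalar1 scale1r.
Qed.

(** The second case is needed when [B] is empty: the Minkowski functional is then
the infimum of the empty set, which is 0. *)
Lemma disk_sup_ball v : `|v| < 1 -> B (f v) \/ v = 0.
Proof.
rewrite f_norm -(real_scalar1 R k) ltr_real_scalar /Defs.minkowski.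
set L := (X in inf X) => L1.
have L_lb : has_lbound L by exists 0 => l [/ltW].
have [L_ex|/set0P/negP/negPn/eqP L0] := pselect (L !=set0); last first.
  right; apply/normr0_eq0.
  by rewrite f_norm /Defs.minkowski -/L L0 inf0 real_scalar0.
left; have [|l [l0 [b Bb <-]] l1] :=
  @inf_adherent R L (1 - inf L) _ (conj L_ex L_lb).
  by rewrite subr_gt0.
rewrite addrC subrK in l1.
rewrite -[_ *: _]addr0 -(scale0r b); apply: B_convex => //.
rewrite normr0 addr0 ger0_norm; last first.
  by rewrite -(real_scalar0 R k) ler_real_scalar ltW.
by rewrite -(real_scalar1 R k) ler_real_scalar ltW.
Qed.

End Minkowski.
End BanachDisks.

(** * Baire's theorem and Grothendieck's factorization theorem *)

Section CompleteNormed.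
Context (K : numFieldType).
Hypothesis dyadic : forall e : K, 0 < e -> exists n, 2^-1 ^+ n < e.

Let half_ge0 : 0 <= 2^-1 :> K. Proof. by rewrite invr_ge0. Qed.
Let half_le1 : 2^-1 <= 1 :> K. Proof. by rewrite invf_le1// ler1n. Qed.

(** The steps [r n] decrease geometrically, so each tail of the series sums to at
most [2 r n]. *)
Lemma geometric_limit (V : completeNormedModType K) (u : nat -> V) (r : nat -> K) :
  (forall n, `|u n.+1 - u n| <= r n) -> (forall n, r n.+1 <= r n / 2) ->
  exists l, forall n, `|l - u n| <= r n * 2.
Proof.
move=> ur r2; have r0 n : 0 <= r n by apply: le_trans (ur n).
have rgeo n : r n <= r 0%N * 2^-1 ^+ n.
  elim: n => [|n IHn]; first by rewrite expr0 mulr1.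
  by rewrite (le_trans (r2 n))// exprSr mulrA ler_wpM2r.
have dist n k : `|u (n + k)%N - u n| <= (r n - r (n + k)%N) * 2.
  elim: k => [|k IHk]; first by rewrite addn0 !subrr normr0 mul0r.
  rewrite addnS -(subrK (u (n + k)%N) (u (n + k).+1)) -addrA.
  rewrite (le_trans (ler_normD _ _))// (le_trans (lerD (ur _) IHk))//.
  have := r2 (n + k)%N; rewrite ler_pdivlMr// => r2'.
  rewrite !mulrBl addrCA lerD2l -[X in X - _]mulr1 -mulrBr.
  rewrite -opprB mulrN lerN2 (_ : 2 - 1 = 1 :> K) ?mulr1//.
  by rewrite -[2]/(1 + 1) addrK.
have /cvg_ex[/= l ul] : cvg (u @ \oo).
  suff : cauchy_ex (u @ \oo) by move=> /cauchy_exP; exact: cauchy_cvg.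
  move=> e e0; rewrite /fmapE.
  have [n ne] : exists n, 2^-1 ^+ n < e / (r 0%N * 2 + 1).
    by apply: dyadic; rewrite divr_gt0// ltr_wpDl// mulr_ge0.
  exists (u n); exists n => // m /= /subnKC <-.
  rewrite -ball_normE /= distrC (le_lt_trans (dist _ _))//.
  rewrite ltr_pdivlMr ?ltr_wpDl ?mulr_ge0// in ne; apply: le_lt_trans ne.
  rewrite mulrBl (@le_trans _ _ (r n * 2))//; first by rewrite gerBl mulr_ge0.
  rewrite [leRHS]mulrDr mulr1 ler_wpDr ?exprn_ge0// mulrA ler_wpM2r// mulrC.
  exact: rgeo.
exists l => n; apply/ler_addgt0Pl => e e0.
have [N _ Ne] := (proj1 (cvgrPdist_lt _ _) ul) e e0.
have := Ne (n + N)%N (leq_addl _ _) => /= lN.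
rewrite -(subrK (u (n + N)%N) l) -addrA (le_trans (ler_normD _ _))//.
by rewrite lerD ?(ltW lN)// (le_trans (dist _ _))// mulrBl gerBl mulr_ge0.
Qed.

(** Baire's theorem for a countable cover: some [A i] is dense in a ball.
Otherwise nested balls can be chosen such that the [n]-th one avoids the [n]-th
set, and their common point lies in no [A i]. *)
Lemma baire_cover (V : completeNormedModType K) (I : countType) (A : I -> set V) :
  \bigcup_i A i = setT ->
  exists i v r, 0 < r /\ forall w, `|w - v| < r ->
    forall e, 0 < e -> exists2 a, A i a & `|w - a| < e.
Proof.
move=> A_cover; apply: contrapT => nA.
(* [P n vr ws]: the ball [ws] avoids the set coded by [n], and the quartered
   radius keeps the limit of the centres strictly inside every ball. *)
pose P n (vr ws : V * K) := 0 < vr.2 ->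
  [/\ `|ws.1 - vr.1| <= vr.2 / 2 / 2, 0 < ws.2, ws.2 <= vr.2 / 2 &
      forall i a, pickle i = n -> A i a -> ~ `|ws.1 - a| < ws.2].
have step (nvr : nat * (V * K)) : exists ws, P nvr.1 nvr.2 ws.
  case: nvr => n [v r]; rewrite /P /=.
  have [r0|r0] := pselect (0 < r); last by exists (0, 0).
  have q0 : 0 < r / 2 by rewrite divr_gt0.
  have [[i ni]|nn] := pselect (exists i : I, pickle i = n); last first.
    exists (v, r / 2); split=> //=; first by rewrite subrr normr0 ltW// divr_gt0.
    by move=> i a ni; exfalso; apply: nn; exists i.
  have [w [e [wv e0 wA]]] : exists w e, [/\ `|w - v| < r / 2 / 2, 0 < e &
      forall a, A i a -> ~ `|w - a| < e].
    apply: contrapT => nw; apply: nA; exists i, v, (r / 2 / 2).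
    split=> [|w wv e e0]; first by rewrite divr_gt0.
    apply: contrapT => na; apply: nw; exists w, e; split=> // a Aa wa.
    by apply: na; exists a.
  have inji i' : pickle i' = n -> i' = i.
    by rewrite -ni => /(pcan_inj pickleK).
  (* The order of [K] is partial, but positive scalars are comparable. *)
  have [er|re] := real_leP (gtr0_real e0) (gtr0_real q0).
    by exists (w, e); split=> //=; [exact: ltW|move=> i' a /inji ->; exact: wA].
  exists (w, r / 2); split=> //=; first exact: ltW.
  by move=> i' a /inji -> /wA wa /lt_trans/(_ re).
have [F FP] := choice step.
pose s := fix s n := if n is n'.+1 then F (n', s n') else (0, 1).
have s0 n : 0 < (s n).2.
  by elim: n => [|n /(FP (n, s n))[]//]; exact: ltr01.
have sP n := FP (n, s n) (s0 n).
have [||l lP] := @geometric_limit V (fun n => (s n).1) (fun n => (s n).2 / 2 / 2).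
- by move=> n; have [] := sP n.
- by move=> n; have [_ _ s2 _] := sP n; rewrite !ler_wpM2r.
have [i _ Ail] : (\bigcup_i A i) l by rewrite A_cover.
have [_ _ _ sA] := sP (pickle i); apply: (sA i l) => //.
rewrite distrC (le_lt_trans (lP (pickle i).+1))// divfK//.
by rewrite ltr_pdivrMr// ltr_pMr// ltr1n.
Qed.

Section Factorization.
Context (V : completeNormedModType K) (W : nat -> completeNormedModType K).
Context (E : tvsType K) (f : {linear V -> E}) (g : forall n, {linear W n -> E}).
Hypothesis E_separated : forall x : E, (forall U, nbhs (0 : E) U -> U x) -> x = 0.
Hypothesis f_continuous : forall U, nbhs (0 : E) U -> nbhs (0 : V) (f @^-1` U).
Hypothesis g_continuous : forall n, continuous (g n).
Hypothesis f_range : range f `<=` \bigcup_n range (g n).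

(** Baire's theorem applied to the sets of those [v] such that [f v] is the image
of a vector of [W n] of norm at most [2 ^ m].  One of them is dense in a ball
around some [v0]; being absolutely convex, it is dense in the ball of the same
radius around 0, and scaling gives the approximation property at every size
[t]. *)
Lemma almost_factor : exists n c, 0 < c /\
  forall t v, 0 < t -> `|v| <= t -> exists a x,
    [/\ `|v - a| <= t / 2, f a = g n x & `|x| <= c * t].
Proof.
pose A (nm : nat * nat) :=
  [set v | exists2 x, `|x| <= 2 ^+ nm.2 & f v = g nm.1 x].
have [|[n m] [v0 [r [r0 Ar]]]] := @baire_cover V _ A.
  rewrite -subTset => v _; have [n _ [x _ gx]] := f_range (imageT f v).
  have x1 : 0 < `|x| + 1 by rewrite ltr_wpDl.
  have [m mx] := dyadic (divr_gt0 ltr01 x1).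
  exists (n, m) => //; exists x => //=.
  rewrite div1r exprVn ltf_pV2 ?posrE ?exprn_gt0// in mx.
  by rewrite (le_trans _ (ltW mx))// lerDl.
exists n, (2 ^+ m * (2 / r)); split; first by rewrite mulr_gt0 ?exprn_gt0 ?divr_gt0.
(* Symmetrization: [w] is half the difference of [v0 + w] and [v0 - w]. *)
have small w : `|w| < r -> exists a x,
    [/\ `|w - a| <= r / 2 / 2, f a = g n x & `|x| <= 2 ^+ m].
  move=> wr; have e0 : 0 < r / 2 / 2 by rewrite !divr_gt0.
  have [|a1 [x1 x1m fa1] wa1] := Ar (v0 + w) _ _ e0.
    by rewrite addrAC subrr add0r.
  have [|a2 [x2 x2m fa2] wa2] := Ar (v0 - w) _ _ e0.
    by rewrite addrAC subrr add0r normrN.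
  exists (2^-1 *: (a1 - a2)), (2^-1 *: (x1 - x2)); split.
  - have -> : w - 2^-1 *: (a1 - a2) = 2^-1 *: ((v0 + w - a1) - (v0 - w - a2)).
      have -> : v0 + w - a1 - (v0 - w - a2) = 2 *: w - (a1 - a2).
        rewrite opprD opprK addrACA; congr (_ + _); last first.
          by rewrite opprB addrC.
        by rewrite opprD opprK addrACA subrr add0r scaler_nat mulr2n.
      by rewrite [RHS]scalerBr scalerA mulVf// scale1r.
    rewrite normrZ ger0_norm// mulrC ler_pdivrMr//.
    rewrite (le_trans (ler_normB _ _))// mulr_natr mulr2n.
    by rewrite lerD// ltW.
  - by rewrite !linearZ/= !linearB/= fa1 fa2.
  - rewrite normrZ ger0_norm// mulrC ler_pdivrMr// (le_trans (ler_normB _ _))//.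
    by rewrite mulr_natr mulr2n lerD.
move=> t v t0 vt; pose b := r / 2 / t.
have b0 : 0 < b by rewrite !divr_gt0.
have bV : b^-1 = 2 / r * t by rewrite /b !invf_div mulrC.
have [|a [x [wa fa xm]]] := small (b *: v).
  rewrite normrZ gtr0_norm//; apply: (@le_lt_trans _ _ (r / 2)).
    by rewrite /b -ler_pdivlMl// invf_div divfK// gt_eqF// divr_gt0.
  by rewrite ltr_pdivrMr// ltr_pMr// ltr1n.
exists (b^-1 *: a), (b^-1 *: x); split.
- have -> : v - b^-1 *: a = b^-1 *: (b *: v - a).
    by rewrite scalerBr scalerA mulVf ?gt_eqF// scale1r.
  rewrite normrZ gtr0_norm ?invr_gt0// mulrC ler_pdivrMr//.
  by rewrite (le_trans wa)// [leRHS]mulrAC /b [t * _]mulrC divfK// gt_eqF.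
- by rewrite !linearZ/= fa.
- by rewrite normrZ gtr0_norm ?invr_gt0// mulrC -mulrA -bV ler_wpM2r// invr_ge0 ltW.
Qed.

(** Iterating the approximation decomposes [v] into a series whose terms map into
[g n] of a geometrically small series in [W n]. The sum [y] of the latter
satisfies [f v = g n y], since the difference is in every neighbourhood of 0. *)
Lemma banach_factorization : exists n c, 0 < c /\ f @` cball 1 `<=` g n @` cball c.
Proof.
have [n [c [c0 cP]]] := almost_factor.
exists n, (c * 2); split; first by rewrite mulr_gt0.
move=> _ [v v1 <-].
have step (kw : nat * V) : exists ax : V * W n, `|kw.2| <= 2^-1 ^+ kw.1 ->
    [/\ `|kw.2 - ax.1| <= 2^-1 ^+ kw.1.+1, f ax.1 = g n ax.2 &
        `|ax.2| <= c * 2^-1 ^+ kw.1].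
  case: kw => k w /=; have [wk|] := pselect (`|w| <= 2^-1 ^+ k); last first.
    by exists (0, 0).
  have k0 : 0 < 2^-1 ^+ k :> K by rewrite exprn_gt0// invr_gt0.
  have [a [x [wa fa xc]]] := cP _ w k0 wk.
  by exists (a, x) => _; rewrite exprSr.
have [F FP] := choice step.
pose s := fix s k := if k is k'.+1 then
  ((s k').1 - (F (k', (s k').1)).1, (s k').2 + (F (k', (s k').1)).2)
  else (v, 0 : W n).
have sv k : `|(s k).1| <= 2^-1 ^+ k.
  by elim: k => [|k /(FP (k, (s k).1))[]//]; exact: v1.
have sP k := FP (k, (s k).1) (sv k).
(* [s k] holds the remainder of [v] and the partial sum in [W n]. *)
have sf k : f v = f (s k).1 + g n (s k).2.
  elim: k => [|k ->] /=; first by rewrite linear0 addr0.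
  have [_ fa _] := sP k.
  by rewrite linearB linearD /= fa addrACA addNr addr0.
have [||y yP] := @geometric_limit (W n) (fun k => (s k).2) (fun k => c * 2^-1 ^+ k).
- by move=> k; have [_ _] := sP k; rewrite /= addrAC subrr add0r.
- by move=> k; rewrite exprSr mulrA.
exists y; first by have := yP 0%N; rewrite /= subr0 expr0 mulr1.
apply/esym/eqP; rewrite -subr_eq0; apply/eqP/E_separated => U U0.
have := @add_continuous E (0, 0) U; rewrite /= addr0 => /(_ U0).
move=> [[U1 U2] /= [nU1 nU2] U12].
have /nbhs_ballP[d1 d10 dU1] := f_continuous nU1.
have /nbhs_ballP[d2 d20 dU2] : nbhs (0 : W n) (g n @^-1` U2).
  by apply: g_continuous; rewrite linear0.
have [k1 k1d] := dyadic d10.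
have [k2 k2d] : exists k, 2^-1 ^+ k < d2 / (c * 2).
  by apply: dyadic; rewrite divr_gt0 ?mulr_gt0.
have -> : f v - g n y = f (s (k1 + k2)%N).1 + g n ((s (k1 + k2)%N).2 - y).
  by rewrite linearB addrA -sf.
apply: (U12 (_, _)); split => /=.
  apply: dU1; rewrite -ball_normE /= sub0r normrN (le_lt_trans (sv _))//.
  by apply: le_lt_trans k1d; rewrite ler_wiXn2l// leq_addr.
apply: dU2; rewrite -ball_normE /= sub0r normrN distrC (le_lt_trans (yP _))//.
rewrite ltr_pdivlMr ?mulr_gt0// in k2d; apply: le_lt_trans k2d.
by rewrite mulrAC [leRHS]mulrC ler_wpM2l ?mulr_ge0 ?(ltW c0)// ler_wiXn2l// leq_addl.
Qed.

End Factorization.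
End CompleteNormed.

(** * The equivalence *)

Lemma born_iso_refl (K : numFieldType) (X : bvs K) : born_iso X X.
Proof.
by exists (idfun : {linear X -> X}), (idfun : {linear X -> X});
  split=> // A bA; rewrite image_id.
Qed.

Lemma born_colimit_iso (K : numFieldType) (S : banach_seq K) (X Y : bvs K)
    (j : forall n, {linear born_of (S n) -> X}) :
  born_iso Y X -> born_colimit j -> in_LBb Y.
Proof.
move=> [f [g [fb gb fK gK]]] [[jb jc] jU].
exists S, (fun n => g \o j n : {linear _ -> _}); split.
  split=> [n A bA|n x /=]; last by rewrite jc.
  by rewrite -(image_comp (j n) g); apply/gb/jb.
move=> Z z zc; have [h [hb hj hU]] := jU Z z zc.
exists (h \o f : {linear _ -> _}); split=> [A bA|n x /=|h' h'b h'j x /=].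
- by rewrite -(image_comp f h); apply/hb/fb.
- by rewrite gK hj.
- rewrite -(hU (h' \o g : {linear _ -> _})) /= ?fK//.
  by move=> A bA; rewrite -(image_comp g h'); apply/h'b/gb.
Qed.

Section Equivalence.
Context (R : realType) (k : scalar_kind).
Local Notation K := (base_field R k).

Lemma LBb_CBorn (X : bvs K) : in_LBb X -> in_CBorn X.
Proof.
move=> [S [j jB]] A bA; have [n [r [r0 Ar]]] := born_colimit_bounded jB bA.
have jI : injective (j n).
  apply: (direct_limit_inj (born_colimit_direct_limit jB)).
  exact: banach_link_inj.
(* Composing with the homothety of ratio [r] turns the ball of radius [r] into
   the unit ball of a Banach space. *)
have [f fE] : exists f : {linear S n -> X}, forall x, f x = r *: j n x.
  apply: linear_bundle => a x y.
  by rewrite linearP scalerDr !scalerA mulrC.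
exists (f @` cball 1); split.
- move=> a /Ar[x xr <-]; exists (r^-1 *: x).
    by rewrite /cball/= normrZ gtr0_norm ?invr_gt0// mulrC ler_pdivrMr// mul1r.
  by rewrite fE linearZ /= scalerA divff ?gt_eqF// scale1r.
- apply: (@bounded_subset _ _ _ (j n @` cball r)).
    move=> _ [x x1 <-]; exists (r *: x); last by rewrite fE linearZ.
    by rewrite /cball/= normrZ gtr0_norm// ler_piMr// ltW.
  by have [[jb _] _] := jB; apply: jb; exact: vn_bounded_cball.
- apply: unit_ball_banach_disk => x y; rewrite !fE => /(scalerI _)/jI; apply.
  by rewrite gt_eqF.
Qed.

Section LB.
Context (E : tvsType K).
Hypothesis E_CBorn : in_CBorn (born_of E).

(** The set [N] of all such [x] is bounded and stable under nonzero scalars.  In a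
Banach disk containing [N], its elements have Minkowski functional 0, hence come
from vectors of norm 0. *)
Lemma CBorn_separated (x : E) : (forall U, nbhs (0 : E) U -> U x) -> x = 0.
Proof.
move: x; pose N := [set x : E | forall U, nbhs 0 U -> U x].
have NZ x (l : K) : l != 0 -> N x -> set_scale l N x.
  move=> l0 Nx; exists (l^-1 *: x); last by rewrite scalerA divff// scale1r.
  move=> U U0; have [u Uu <-] := Nx _ (nbhs0Z l0 U0).
  by rewrite scalerA mulVf// scale1r.
have [|B [NB bB [Bc [V [f [fI fr fn]]]]]] := E_CBorn (A := N).
  move=> U U0; exists 1 => // l l1 x /(NZ x l)[]; last first.
    by move=> y Ny <-; exists y => //; exact: Ny.
  by rewrite -normr_gt0 (lt_le_trans ltr01).
move=> x Nx; have [v _ vx] := disk_sub_cball fr fn (NB _ Nx).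
rewrite -vx (_ : v = 0) ?linear0//; apply/normr0_eq0/eqP.
rewrite eq_le normr_ge0 andbT fn vx -(real_scalar0 R k) ler_real_scalar.
apply/ler_addgt0Pl => e e0; rewrite addr0; apply: ge_inf.
  by exists 0 => l [/ltW].
split=> //; have [|y Ny <-] := NZ x (real_scalar k e) _ Nx.
  by rewrite gt_eqF// -(real_scalar0 R k) ltr_real_scalar.
by exists y => //; exact: NB.
Qed.

Lemma disk_continuous (B : set E) (V : completeNormedModType K)
    (f : {linear V -> E}) :
  vn_bounded B -> absolutely_convex B ->
  (forall v, `|v| = real_scalar k (Defs.minkowski (X := born_of E) B (f v))) ->
  forall U, nbhs (0 : E) U -> nbhs (0 : V) (f @^-1` U).
Proof.
move=> bB Bc fn U U0; have [r r0 rB] := bB U U0.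
apply/nbhs_ballP; exists r^-1; first by rewrite /= invr_gt0.
move=> v; rewrite -ball_normE /= sub0r normrN => vr.
have [|Bv|] := @disk_sup_ball R k (born_of E) B V f Bc fn (r *: v).
- by rewrite normrZ gtr0_norm// mulrC -ltr_pdivlMr// div1r.
- have [|u Uu] := rB r _ _ Bv; first by rewrite gtr0_norm.
  by rewrite linearZ => /(scalerI (lt0r_neq0 r0)) <-.
move=> /eqP; rewrite scaler_eq0 gt_eqF//= => /eqP ->.
by rewrite linear0; exact: nbhs_singleton.
Qed.

(** By the factorization theorem any defining sequence of [E] computes the
bounded sets of [E], so the colimit cocone at hand is also a colimit of
bornological spaces. *)
Lemma CBorn_regular : LB_space E -> regular_LB_space E.
Proof.
move=> [S [j jT]]; exists S, j; split=> //.
have jL := tc_colimit_direct_limit jT; have jcov := direct_limit_cover jL.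
have [[jC jc] _] := jT; have [_ jE jU] := jL.
split=> [|Y g [gb gc]].
  by split=> // n A; apply: linear_vn_bounded; exact: jC.
have [h hj] := jE Y g gc.
exists h; split=> // [A bA|h' _ h'j]; last by apply: jU => n x; rewrite hj h'j.
have [B [AB bB [Bc [V [f [fI fr fn]]]]]] := E_CBorn bA.
have [|n [c [c0 fc]]] := banach_factorization (@dyadic_lt R k) CBorn_separated
  (disk_continuous bB Bc fn) jC.
  by rewrite jcov.
apply: (@bounded_subset _ _ _ (g n @` cball c)); last first.
  by apply: gb; exact: vn_bounded_cball.
move=> _ [a /AB/(disk_sub_cball fr fn)/fc[x xc <-] <-].
by exists x => //; rewrite hj.
Qed.

End LB.
End Equivalence.

Theorem theorem3p12 (R : realType) (k : scalar_kind)
    (E : tvsType (base_field R k)) (hE : LB_space E) :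
  [<-> regular_LB_space E;
       in_bLB (born_of E);
       in_LBb (born_of E);
       in_CBorn (born_of E)].
Proof.
split=> [E_reg|]; first by exists E => //; exact: born_iso_refl.
split=> [[F [S [j [_ jB]]] EF]|]; first exact: born_colimit_iso EF jB.
split=> [|E_CBorn]; first exact: LBb_CBorn.
exact: CBorn_regular.
Qed.
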